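(* Let $f\in\mathcal S^0_{\mu_f}(\mathcal X)$ with $\mu_f\ge0$. Let $\{\beta_k\}_{k\ge1}$ be a positive nondecreasing sequence with $\lim_{k\to+\infty}\beta_k=+\infty$, let $\{\alpha_k\}_{k\ge1}$ be a positive sequence, and suppose that $\delta,\gamma>0$ satisfy, for every $k\ge 1$, $$\delta\gamma-1\ge 0,\qquad \delta\beta_{k+1}\le \delta\beta_k+\alpha_k\beta_k .$$ Let $\{(x_k,\lambda_k)\}_{k\ge1}$ be the sequence generated by the Primal-dual Algorithm (defined in the context) and let $(x^*,\lambda^* )\in\Omega$. Assume that $\{\epsilon_k\}_{k\ge1}$ is a nonincreasing sequence of nonnegative numbers with $\sum_{k=1}^{+\infty}\alpha_k\beta_k\epsilon_k<+\infty$. Then the sequence $\{(x_k,\lambda_k)\}_{k\ge1}$ is bounded and, as $k\to+\infty$, $$\mathcal L(x_k,\lambda^* )-\mathcal L(x^*,\lambda^* )=\mathcal O\!\left(\frac1{\beta_k}\right),\quad |f(x_k)-f(x^* )|=\mathcal O\!\left(\frac1{\beta_k}\right),\quad \|Ax_k-b\|=\mathcal O\!\left(\frac1{\beta_k}\right).$$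
   Context: $\mathcal X,\mathcal Z$ are real Hilbert spaces. The problem is $\min_{x\in\mathcal X}f(x)$ subject to $Ax=b$, where $f:\mathcal X\to\mathbb R\cup\{+\infty\}$ is proper, convex, lower semicontinuous, $A:\mathcal X\to\mathcal Z$ is a continuous linear operator, $b\in\mathcal Z$, and the set of optimal solutions is nonempty. $\mathcal S^0_\mu(\mathcal X)$ ($\mu\ge0$) is the set of proper, closed, lower semicontinuous convex functions $f$ on $\mathcal X$ such that $f(x_1)-f(x_2)-\langle w,x_1-x_2\rangle\ge\frac\mu2\|x_1-x_2\|^2$ for all $x_1,x_2\in\mathcal X$ and $w\in\partial f(x_2)$ (convex subdifferential). Lagrangian: $\mathcal L(x,\lambda)=f(x)+\langle\lambda,Ax-b\rangle$. Augmented Lagrangian: $\mathcal L_\theta(x,\lambda)=\mathcal L(x,\lambda)+\frac\theta2\|Ax-b\|^2$. $\Omega$ is the set of saddle points: $(x^*,\lambda^* )\in\Omega$ iff $\mathcal L(x^*,\lambda)\le\mathcal L(x^*,\lambda^* )\le\mathcal L(x,\lambda^* )$ for all $(x,\lambda)\in\mathcal X\times\mathcal Z$. Primal-dual Algorithm. Parameters: $\delta>0$, $\gamma>0$, sequences $\alpha_k>0$, $\beta_k>0$, $\epsilon_k\ge0$. Initialize $x_1=x_0=\frac1\gamma Z_1$, $\lambda_1=\lambda_0$. For $k=1,2,\dots$: $\theta_k=(\alpha_k+\delta)\beta_k$, $\eta_{f,k}=\gamma+\frac1{\alpha_k}+\mu_f\delta\beta_k$, $\widetilde\lambda_k=\lambda_k-\delta\beta_k(Ax_k-b)$,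 $\widetilde x_k=x_k+\frac{Z_k-\gamma x_k}{\eta_{f,k}}$, $$x_{k+1}=\arg\min_{x\in\mathcal X}\Big(\mathcal L_{\theta_k}(x,\widetilde\lambda_k)+\frac{\eta_{f,k}}{2\alpha_k\beta_k}\|x-\widetilde x_k\|^2+\frac{\epsilon_k}2\|x\|^2\Big);$$ then $Z_{k+1}=(\gamma+\frac1{\alpha_k})x_{k+1}-\frac1{\alpha_k}x_k$, $Z^\delta_{k+1}=\delta Z_{k+1}+(1-\delta\gamma)x_{k+1}$, $\lambda_{k+1}=\lambda_k+\alpha_k\beta_k(AZ^\delta_{k+1}-b)$. *)

(* Defs.v *)
From HB Require Import structures.
From mathcomp Require Import all_boot all_order all_algebra.
From mathcomp Require Import all_classical all_reals all_analysis.

Set Implicit Arguments.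
Unset Strict Implicit.
Unset Printing Implicit Defensive.

Import Order.TTheory GRing.Theory Num.Theory.
Import numFieldNormedType.Exports.

Local Open Scope classical_set_scope.
Local Open Scope ring_scope.

(* A real Hilbert space: a Banach space whose norm comes from an inner product. *)
HB.mixin Record CompleteNormedModule_isHilbert (R : realType) X
    of CompleteNormedModule R X := {
  inner : {dot X for @idfun R} ;
  inner_norm : forall x : X, inner x x = `|x| ^+ 2
}.

#[short(type="hilbertType")]
HB.structure Definition Hilbert (R : realType) :=
  {X of CompleteNormedModule R X & CompleteNormedModule_isHilbert R X}.

Notation "''[' u , v ]" := (inner u v)
  (format "''[' u ,  v ]") : ring_scope.

Section ConvexFunctions.
Context {R : realType} {X : hilbertType R}.
Implicit Types (f : X -> \bar R) (x y w : X).
Local Open Scope ereal_scope.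

Definition proper f := (forall x, f x != -oo) /\ exists x, f x < +oo.

Definition convex_efun f := forall x y (t : R), (0 <= t <= 1)%R ->
  f (t *: x + (1 - t) *: y)%R <= t%:E * f x + (1 - t)%:E * f y.

(* For a proper f this is empty at every x with f x = +oo. *)
Definition subdifferential f x : set X :=
  [set w | forall y, f x + '[w, y - x]%:E <= f y].

(* For a proper f, f x2 is finite as soon as its subdifferential at x2 is
   nonempty, so f x1 - f x2 below is never +oo - +oo. A proper function is
   closed when it is lower semicontinuous, so closedness is not repeated. *)
Definition S0 (mu : R) f :=
  [/\ proper f, convex_efun f, lower_semicontinuous f &
      forall x1 x2 w, subdifferential f x2 w ->
        (mu / 2 * `|x1 - x2| ^+ 2)%:E <= f x1 - f x2 - '[w, x1 - x2]%:E].

Definition argmin (g : X -> \bar R) : set X :=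
  [set x | forall y, g x <= g y].

End ConvexFunctions.

Section Problem.
Context {R : realType} {X Z : hilbertType R}.
Variables (f : X -> \bar R) (A : {linear X -> Z}) (b : Z).
Local Open Scope ereal_scope.

Definition solutions : set X :=
  [set x | A x = b /\ forall y, A y = b -> f x <= f y].

Definition lagrangian (x : X) (lam : Z) : \bar R :=
  f x + '[lam, A x - b]%:E.

Definition aug_lagrangian (theta : R) (x : X) (lam : Z) : \bar R :=
  lagrangian x lam + (theta / 2 * `|A x - b| ^+ 2)%:E.

Definition saddle_points : set (X * Z) :=
  [set s | forall x lam,
     lagrangian s.1 lam <= lagrangian s.1 s.2 /\
     lagrangian s.1 s.2 <= lagrangian x s.2].

End Problem.

(* The parameters alpha, beta and epsilon are indexed from 1: their values at 0
   are junk. x 0 and lam 0 are the initial points; zeta 0 is junk. The objective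
   minimized at each step is strongly convex and proper, so its argmin has at
   most one element. *)
Definition primal_dual_algorithm {R : realType} {X Z : hilbertType R}
    (f : X -> \bar R) (A : {linear X -> Z}) (b : Z) (mu delta gamma : R)
    (alpha beta epsilon : nat -> R)
    (x : nat -> X) (zeta : nat -> X) (lam : nat -> Z) : Prop :=
  [/\ x 1 = x 0, x 0 = gamma^-1 *: zeta 1, lam 1 = lam 0 &
  forall k, (1 <= k)%N ->
    let theta := (alpha k + delta) * beta k in
    let eta := gamma + (alpha k)^-1 + mu * delta * beta k in
    let lamt := lam k - (delta * beta k) *: (A (x k) - b) in
    let xt := x k + eta^-1 *: (zeta k - gamma *: x k) in
    let zetad := delta *: zeta k.+1 + (1 - delta * gamma) *: x k.+1 in
    [/\ argmin (fun y => aug_lagrangian f A b theta y lamt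
                    + (eta / (2 * alpha k * beta k) * `|y - xt| ^+ 2)%:E
                    + (epsilon k / 2 * `|y| ^+ 2)%:E)%E (x k.+1),
        zeta k.+1 = (gamma + (alpha k)^-1) *: x k.+1 - (alpha k)^-1 *: x k &
        lam k.+1 = lam k + (alpha k * beta k) *: (A zetad - b)]].

(* u k = O(v k) as k tends to infinity, for u extended-real valued: in
   particular u k is finite for all large k. *)
Definition ebigO {R : realType} (u : nat -> \bar R) (v : nat -> R) : Prop :=
  exists C : R, \forall k \near \oo, (`|u k| <= (C * `|v k|)%:E)%E.

(* Main.v *)
(* Put v_k = Z_k - gamma x_k = (x_k - x_(k-1)) / alpha_(k-1) and
   D_k = L(x_k, lambda^* ) - L(x^*, lambda^* ). The optimality condition of the
   proximal subproblem is an implicit Euler step for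
   x'' + gamma x' + beta (df(x) + A^* lambda + mu delta x' + eps x) = 0, and the
   Lyapunov function
     delta^2 beta_k D_k + |x_k - x^* + delta v_k|^2 / 2
       + (delta gamma - 1) |x_k - x^*|^2 / 2 + delta |lambda_k - lambda^*|^2 / 2
       + mu delta^2 beta_k |x_k - x^*|^2 / 2
       + delta^2 beta_k eps_k |x_k|^2 / 2
   grows by at most delta |x^*|^2 alpha_k beta_k eps_k / 2 per step, hence is
   bounded. This is only meaningful for k >= 2, since f(x_1) may be infinite.
   When delta gamma = 1 the energy does not control x_k - x^* directly, but
   x_(k+1) - x^* is a convex combination of x_k - x^* and
   x_(k+1) - x^* + delta v_(k+1). Likewise
   delta beta_(k+1) (A x_(k+1) - b) - lambda_(k+1) is a convex combination of
   its predecessor and - lambda_(k+1), so the boundedness of lambda gives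
   |A x_k - b| = O(1 / beta_k). *)

Require Import Defs.
From HB Require Import structures.
From mathcomp Require Import all_boot all_order all_algebra.
From mathcomp Require Import all_classical all_reals all_analysis.
From mathcomp Require Import ring lra.

Set Implicit Arguments.
Unset Strict Implicit.
Unset Printing Implicit Defensive.

Import Order.TTheory GRing.Theory Num.Theory.
Import numFieldNormedType.Exports.

Local Open Scope classical_set_scope.
Local Open Scope ring_scope.

(** * Hilbert space tools: inner product identities, Riesz representation, adjoints *)

Section InnerProduct.
Context {R : realType} {X : hilbertType R}.
Implicit Types (u v w : X) (a : R).

Lemma innerC u v : '[u, v] = '[v, u].
Proof. by rewrite hermC expr0 mul1r. Qed.

Lemma innerDl u v w : '[u + v, w] = '[u, w] + '[v, w].
Proof. exact: linearDl. Qed.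

Lemma innerDr u v w : '[w, u + v] = '[w, u] + '[w, v].
Proof. exact: linearDr. Qed.

Lemma innerNl u v : '[- u, v] = - '[u, v].
Proof. exact: linearNl. Qed.

Lemma innerNr u v : '[v, - u] = - '[v, u].
Proof. exact: linearNr. Qed.

Lemma innerZl a u v : '[a *: u, v] = a * '[u, v].
Proof. exact: linearZl_LR. Qed.

Lemma innerZr a u v : '[v, a *: u] = a * '[v, u].
Proof. by rewrite innerC innerZl innerC. Qed.

Definition innerE := (innerDl, innerDr, innerNl, innerNr, innerZl, innerZr).

Lemma inner_ge0 u : 0 <= '[u, u].
Proof. by rewrite inner_norm sqr_ge0. Qed.

Lemma sqr_normD u v : `|u + v| ^+ 2 = `|u| ^+ 2 + 2 * '[u, v] + `|v| ^+ 2.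
Proof. by rewrite -!inner_norm !innerE (innerC v u); ring. Qed.

(** Cauchy-Schwarz, read off from the nonnegative square of [|v| u - |u| v], whose expansion has the
    factor [|u| |v|]. *)
Lemma inner_le_norm u v : '[u, v] <= `|u| * `|v|.
Proof.
have [->|u0] := eqVneq u 0; first by rewrite (linear0l inner) normr0 mul0r.
have [->|v0] := eqVneq v 0; first by rewrite (linear0r inner) normr0 mulr0.
have uv_gt0 : 0 < `|u| * `|v| by rewrite mulr_gt0 ?normr_gt0.
have := inner_ge0 (`|v| *: u - `|u| *: v).
rewrite !innerE (innerC v u) !inner_norm => H.
rewrite -(ler_pM2l uv_gt0); nra.
Qed.

Lemma normr_inner_le u v : `|'[u, v]| <= `|u| * `|v|.
Proof.
rewrite ler_norml inner_le_norm andbT lerNl -innerNl.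
by rewrite (le_trans (inner_le_norm _ _))// normrN.
Qed.

End InnerProduct.

(* [w] minimises [|y|^2 - 2 phi y]; minimising sequences are Cauchy by the
   parallelogram identity. *)
Lemma riesz {R : realType} {X : hilbertType R} (phi : {scalar X}) (M : R) :
  (forall y, `|phi y| <= M * `|y|) -> exists w : X, forall y, '[w, y] = phi y.
Proof.
move=> phi_bd.
have phiZ a y : phi (a *: y) = a * phi y by exact: linearZ.
have phiD y z : phi (y + z) = phi y + phi z by exact: linearD.
pose J (y : X) : R := `|y| ^+ 2 - 2 * phi y.
have J_lb : lbound (range J) (- M ^+ 2).
  move=> _ [y _ <-]; rewrite /J.
  have /ler_normlP[_ phiy] := phi_bd y.
  by have := sqr_ge0 (`|y| - M); nra.
have J_hinf : has_inf (range J) by split; [exists (J 0), 0 | exists (- M ^+ 2)].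
set m := inf (range J).
have m_le y : m <= J y by apply: ge_inf; [case: J_hinf | exists y].
have near_min (e : R) : 0 < e -> exists y, J y < m + e.
  by move=> /(inf_adherent)/(_ J_hinf)[_ [y _ <-] ?]; exists y.
have J_parallelogram y z :
    `|y - z| ^+ 2 = 2 * J y + 2 * J z - 4 * J (2^-1 *: (y + z)).
  by rewrite /J phiZ phiD -!inner_norm !innerE (innerC z y); field.
have [s Hs] : exists s : nat -> X, forall n, J (s n) < m + n.+1%:R^-1.
  suff /choice[s Hs] : forall n, exists y, J y < m + n.+1%:R^-1 by exists s.
  by move=> n; apply: near_min; rewrite invr_gt0.
(* A minimiser of [J] up to [e ^+ 2] solves the Euler equation ['[y, d] = phi d] up to [e]; applied
   to [s n], this passes to the limit. *)
have J_grad y e : J y <= m + e ^+ 2 -> 0 < e ->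
    forall d, `|'[y, d] - phi d| <= e * `|d|.
  move=> Jy e0 d.
  have [->|d0] := eqVneq d 0.
    by rewrite (linear0r inner) (linear0 phi) subr0 !normr0 mulr0.
  have dd0 : 0 < `|d| ^+ 2 by rewrite exprn_gt0 ?normr_gt0.
  set g := '[y, d] - phi d.
  have J_line t : J (y + t *: d) = J y + 2 * t * g + t ^+ 2 * `|d| ^+ 2.
    rewrite /J /g phiD phiZ sqr_normD innerZr normrZ exprMn real_normK ?num_real//.
    by ring.
  rewrite -ler_sqr ?nnegrE ?mulr_ge0 ?(ltW e0)// real_normK ?num_real// exprMn.
  (* This step length minimises [J] along the direction [d]; the resulting drop, g^2 / |d|^2, cannot
     exceed [e ^+ 2]. *)
  have := m_le (y + (- g / `|d| ^+ 2) *: d); rewrite J_line.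
  have -> : J y + 2 * (- g / `|d| ^+ 2) * g + (- g / `|d| ^+ 2) ^+ 2 * `|d| ^+ 2
     = J y - g ^+ 2 / `|d| ^+ 2 by field; rewrite normr_eq0.
  move=> H; rewrite -ler_pdivrMr//; lra.
have s_cvg : cvgn s.
  apply/cauchy_cvgP/cauchy_exP => e e0.
  (* In the parallelogram identity both values of [J] are below m + e^2 / 4 and the midpoint value
     is at least [m], so the squared distance is below e^2. *)
  have e2 : 0 < e ^+ 2 / 4 by rewrite divr_gt0 ?exprn_gt0.
  have [N _ HN] := near_infty_natSinv_lt (PosNum e2).
  exists (s N); exists N => //= n /= Nn.
  have {}HN : N.+1%:R^-1 < e ^+ 2 / 4 by exact: (HN N (leqnn N)).
  have nN : n.+1%:R^-1 <= N.+1%:R^-1 :> R by rewrite lef_pV2 ?posrE// ler_nat.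
  rewrite -ball_normE /ball_/=.
  rewrite -ltr_sqr ?nnegrE ?(ltW e0)// J_parallelogram.
  move: HN nN (Hs N) (Hs n) (m_le (2^-1 *: (s N + s n))).
  by move: N.+1%:R^-1 n.+1%:R^-1 => a c; lra.
set y := lim (s @ \oo) in s_cvg *.
exists y => d; apply/eqP; rewrite -subr_eq0 -normr_le0.
apply/ler_addgt0Pl => e e0; rewrite addr0.
have d1 : 0 < `|d| + 1 by rewrite ltr_wpDl.
(* The error splits into two terms, each at most e1 |d| <= e / 2; the added 1 keeps the denominator
   positive. *)
pose e1 := e / 2 / (`|d| + 1).
have e1_gt0 : 0 < e1 by rewrite !divr_gt0.
have [n [sn_y Jsn]] : exists n, `|y - s n| <= e1 /\ J (s n) <= m + e1 ^+ 2.
  have e12 : 0 < e1 ^+ 2 by rewrite exprn_gt0.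
  have [n [Hn1 Hn2]] : exists n, (`|y - s n| < e1) /\ n.+1%:R^-1 < e1 ^+ 2.
    near \oo => n; exists n; split; near: n.
      by move/cvgrPdist_lt : s_cvg; apply.
    exact: near_infty_natSinv_lt (PosNum e12).
  by exists n; split; [exact: ltW | move: Hn2 (Hs n); move: n.+1%:R^-1 => a; lra].
have -> : '[y, d] - phi d = '[y - s n, d] + ('[s n, d] - phi d).
  by rewrite !innerE; ring.
apply: (le_trans (ler_normD _ _)).
apply: (le_trans (lerD (normr_inner_le _ _) (J_grad _ _ Jsn e1_gt0 d))).
have d_ge0 := normr_ge0 d.
have -> : e = e1 * (`|d| + 1) + e1 * (`|d| + 1) by rewrite /e1; field; apply: lt0r_neq0.
apply: lerD; apply: ler_pM => //; first [exact: ltW | lra].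
Unshelve. all: by end_near. Qed.

(** Provides the vector [A^* z] by Riesz; continuity of [A] bounds the functional. *)
Lemma adjoint_vector {R : realType} {X Z : hilbertType R} (A : {linear X -> Z})
    (z : Z) : continuous A -> exists w : X, forall y, '[w, y] = '[z, A y].
Proof.
move=> /(_ 0)/continuous_linear_bounded/linear_boundedP/pinfty_ex_gt0[M _ A_bd].
have phi_lin : scalar (fun y => '[z, A y]).
  by move=> a u v /=; rewrite linearD linearZ /= !innerE.
pose phi_mix := GRing.isLinear.Build _ _ _ _ _ phi_lin.
pose phi : {scalar X} := HB.pack (fun y => '[z, A y]) phi_mix.
apply: (@riesz _ _ phi (`|z| * M)) => y /=.
apply: (le_trans (normr_inner_le _ _)).
by rewrite -mulrA ler_wpM2l.
Qed.

(** * Convex analysis: optimality condition and strong convexity *)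

(** Fermat's rule for a convex function plus a quadratic one. The smooth part enters only through
    its expansion along lines from [x]: [g] is its gradient there and [h] its second-order part. *)
Lemma argmin_subgradient {R : realType} {X : hilbertType R} (f : X -> \bar R)
    (q h : X -> R) (x g : X) :
  Defs.proper f -> convex_efun f -> argmin (fun y => f y + (q y)%:E)%E x ->
  (forall d t, q (x + t *: d) = q x + t * '[g, d] + t ^+ 2 * h d) ->
  f x \is a fin_num /\ subdifferential f x (- g).
Proof.
move=> [f_noo [y0 fy0]] f_cvx x_min q_quad.
have fin y : (f y < +oo)%E -> f y \is a fin_num.
  by move=> fy; rewrite fin_numE f_noo lt_eqF.
have fx_fin : f x \is a fin_num.
  have fy0_fin := fin _ fy0; apply: fin; rewrite ltey; apply/eqP => fx.
  have := x_min y0; rewrite fx -(fineK fy0_fin) -EFinD addye//.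
split => // y.
have [fy|] := ltP (f y) +oo%E; last by rewrite leye_eq => /eqP ->; exact: leey.
have fy_fin := fin _ fy.
rewrite -(fineK fx_fin) -(fineK fy_fin) -EFinD lee_fin innerNl lerBlDr.
set F := fine (f y) + _; set d := y - x in F *.
(* Minimality is tested at a point of the segment from [x] to [y], bounded by convexity of [f], and
   divided by [t]. *)
have step t : 0 < t <= 1 -> fine (f x) <= F + t * h d.
  move=> /andP[t0 t1].
  have xtd : x + t *: d = t *: y + (1 - t) *: x.
    by rewrite /d scalerBr scalerBl scale1r addrCA.
  have t01 : 0 <= t <= 1 by rewrite (ltW t0).
  have := x_min (x + t *: d).
  rewrite q_quad xtd => /le_trans /(_ (leeD2r _ (f_cvx y x t t01))).
  rewrite -(fineK fx_fin) -(fineK fy_fin) -!EFinM -!EFinD lee_fin => H.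
  by rewrite -(ler_pM2l t0) /F; lra.
have [h0|h0] := leP (h d) 0.
  by have := step 1; rewrite ltr01 lexx => /(_ isT); lra.
apply/ler_addgt0Pr => e e0.
have ehd : 0 < e / h d by rewrite divr_gt0.
(* This [t] makes the second-order remainder [t * h d] at most [e] while staying in the segment. *)
have t01 : 0 < Num.min 1 (e / h d) <= 1.
  by rewrite lt_min ltr01 ehd/= ge_min lexx.
apply: (le_trans (step _ t01)); rewrite lerD2l.
by rewrite -ler_pdivlMr// ge_min lexx orbT.
Qed.

Lemma S0_strong_convexity {R : realType} {X : hilbertType R} (f : X -> \bar R)
    (mu : R) (x y w : X) :
  S0 mu f -> subdifferential f x w -> f x \is a fin_num -> f y \is a fin_num ->
  mu / 2 * `|y - x| ^+ 2 <= fine (f y) - fine (f x) - '[w, y - x].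
Proof.
move=> [_ _ _ /(_ y x w)] H /H {}H fx fy.
by move: H; rewrite -{1}(fineK fx) -{1}(fineK fy) -!EFinB lee_fin.
Qed.

(** * The Lyapunov function and its one-step estimate *)

Section Descent.
Context {R : realType} {X Z : hilbertType R}.
Variables (mu delta gamma : R) (xs : X) (lams : Z).

(** All state variables are free, with [D] for the Lagrangian gap and [v] for the velocity, so that
    descent becomes an algebraic inequality between two states. *)
Definition energy (beta eps D : R) (x v : X) (lam : Z) : R :=
  delta ^+ 2 * beta * D + `|x - xs + delta *: v| ^+ 2 / 2
  + (delta * gamma - 1) / 2 * `|x - xs| ^+ 2 + delta / 2 * `|lam - lams| ^+ 2
  + mu * delta ^+ 2 * beta / 2 * `|x - xs| ^+ 2
  + delta ^+ 2 * beta * eps / 2 * `|x| ^+ 2.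

Lemma energy_bounds (beta eps D : R) (x v : X) (lam : Z) :
  0 <= mu -> 0 < delta -> 0 <= delta * gamma - 1 ->
  0 <= beta -> 0 <= eps -> 0 <= D ->
  let E := energy beta eps D x v lam in
  [/\ delta ^+ 2 * beta * D <= E,
      `|x - xs + delta *: v| ^+ 2 / 2 <= E &
      delta / 2 * `|lam - lams| ^+ 2 <= E].
Proof.
move=> mu0 /ltW d0 dg0 b0 e0 D0 E.
have T1 : 0 <= delta ^+ 2 * beta * D by rewrite !mulr_ge0.
have T2 : 0 <= `|x - xs + delta *: v| ^+ 2 / 2 by rewrite !mulr_ge0.
have T3 : 0 <= (delta * gamma - 1) / 2 * `|x - xs| ^+ 2 by rewrite !mulr_ge0.
have T4 : 0 <= delta / 2 * `|lam - lams| ^+ 2 by rewrite !mulr_ge0.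
have T5 : 0 <= mu * delta ^+ 2 * beta / 2 * `|x - xs| ^+ 2 by rewrite !mulr_ge0.
have T6 : 0 <= delta ^+ 2 * beta * eps / 2 * `|x| ^+ 2 by rewrite !mulr_ge0.
by rewrite /E /energy; split; lra.
Qed.

(* [y] stands for [A^* lam'] and [s] for [A v']. *)
Lemma energy_step (alpha beta beta' eps eps' D D' : R) (x x' v v' w y : X)
    (lam lam' r r' s : Z) :
  0 <= mu -> 0 < delta -> 0 <= delta * gamma - 1 -> 0 < alpha -> 0 < beta ->
  0 <= beta' -> 0 <= eps' <= eps ->
  delta * beta' <= delta * beta + alpha * beta -> 0 <= D' ->
  x' = x + alpha *: v' ->
  v = v' + (alpha * gamma) *: v' +
      (alpha * beta) *: (w + y + (mu * delta) *: v' + eps *: x') ->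
  r' = r + alpha *: s ->
  lam' = lam + (alpha * beta) *: (r' + delta *: s) ->
  '[y, x - xs] = '[lam', r] -> '[y, v'] = '[lam', s] ->
  mu / 2 * `|xs - x'| ^+ 2 <= '[lams, r'] - D' - '[w, xs - x'] ->
  mu / 2 * `|x - x'| ^+ 2 <=
    (D - '[lams, r]) - (D' - '[lams, r']) - '[w, x - x'] ->
  energy beta' eps' D' x' v' lam' <=
  energy beta eps D x v lam + delta / 2 * `|xs| ^+ 2 * (alpha * beta * eps).
Proof.
move=> mu0 d0 dg0 a0 b0 b'0 /andP[e'0 e'e] growth D'0 x'E vE r'E lam'E yr ys.
have e0 := le_trans e'0 e'e.
rewrite /energy; set q := x' - xs; set l := lam' - lams; set u := x - xs + _.
have uE : u = x - xs + delta *: v by [].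
have qE : q = x' - xs by [].
have lE : l = lam' - lams by [].
have pE : x - xs = q - alpha *: v' by rewrite qE x'E (addrAC x) addrK.
set m := w + y + (mu * delta) *: v' + eps *: x' in vE.
have mE : m = w + y + (mu * delta) *: v' + eps *: x' by [].
clearbody q l u m.
(* [u] equals [q + delta *: v'] plus an increment in [v'] and [m]; expanding its squared norm and
   dropping the square of the increment gives the bound. *)
have u_le : `|q + delta *: v'| ^+ 2 <= `|u| ^+ 2
    - 2 * (alpha * (delta * gamma - 1) * '[v', q + delta *: v']
           + delta * alpha * beta * '[m, q + delta *: v']).
  rewrite -subr_ge0.
  have := inner_ge0 ((alpha * (delta * gamma - 1)) *: v' + (delta * alpha * beta) *: m).
  congr (0 <= _).
  rewrite uE pE vE -!inner_norm !innerE (innerC m v') (innerC q v') (innerC m q).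
  by ring.
(* The same expansion for the multiplier, again dropping the square of the increment. *)
have lam_le : `|l| ^+ 2 <= `|lam - lams| ^+ 2
    + 2 * (alpha * beta) * ('[l, r'] + delta * '[l, s]).
  have -> : lam - lams = l - (alpha * beta) *: (r' + delta *: s).
    by rewrite lE lam'E (addrAC lam) addrK.
  rewrite -subr_ge0.
  have := inner_ge0 ((alpha * beta) *: (r' + delta *: s)).
  congr (0 <= _).
  rewrite -!inner_norm !innerE (innerC s r') (innerC r' l) (innerC s l).
  by ring.
have -> : `|x - xs| ^+ 2 =
    `|q| ^+ 2 - 2 * alpha * '[v', q] + alpha ^+ 2 * `|v'| ^+ 2.
  by rewrite pE -!inner_norm !innerE (innerC q v'); ring.
have -> : `|x| ^+ 2 =
    `|x'| ^+ 2 - 2 * alpha * '[x', v'] + alpha ^+ 2 * `|v'| ^+ 2.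
  have -> : x = x' - alpha *: v' by rewrite x'E addrK.
  by rewrite -!inner_norm !innerE (innerC v' x'); ring.
(* This polarisation turns the regularisation term ['[x', q]] into squares; the [xs] square is the
   per-step error in the conclusion. *)
have -> : `|xs| ^+ 2 = `|x'| ^+ 2 - 2 * '[x', q] + `|q| ^+ 2.
  have -> : xs = x' - q by rewrite qE opprB addrC subrK.
  by rewrite -!inner_norm !innerE (innerC q x'); ring.
have yq : '[y, q] = '[l, r'] + '[lams, r'].
  have -> : q = (x - xs) + alpha *: v' by rewrite pE subrK.
  rewrite innerDr innerZr yr ys r'E lE !innerE; ring.
have {}ys : '[y, v'] = '[l, s] + '[lams, s] by rewrite ys lE !innerE; ring.
have -> : xs - x' = - q by rewrite qE opprB.
have -> : x - x' = - (alpha *: v') by rewrite x'E opprD addNKr.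
have -> : '[lams, r] = '[lams, r'] - alpha * '[lams, s].
  by rewrite r'E !innerE; ring.
rewrite !normrN normrZ exprMn real_normK ?num_real// !innerNr innerZr.
have {u_le} : `|q + delta *: v'| ^+ 2 <= `|u| ^+ 2
    - 2 * (alpha * (delta * gamma - 1) * ('[v', q] + delta * `|v'| ^+ 2)
     + delta * alpha * beta * ('[w, q] + delta * '[w, v'] + '[l, r'] + '[lams, r'] +
       delta * ('[l, s] + '[lams, s])
       + mu * delta * ('[v', q] + delta * `|v'| ^+ 2)
       + eps * ('[x', q] + delta * '[x', v']))).
  apply: (le_trans u_le); rewrite le_eqVlt; apply/orP; left; apply/eqP.
  rewrite mE !innerE yq ys -(inner_norm v'); ring.
have : 0 <= `|v'| ^+ 2 by rewrite sqr_ge0.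
have : 0 <= `|q| ^+ 2 by rewrite sqr_ge0.
have : 0 <= `|x'| ^+ 2 by rewrite sqr_ge0.
move: lam_le; clear -mu0 d0 dg0 a0 b0 b'0 e'0 e'e growth D'0 e0.
(* From here on every norm and inner product is a real variable. *)
move: (`|v'| ^+ 2) (`|q| ^+ 2) (`|x'| ^+ 2) (`|u| ^+ 2) (`|q + delta *: v'| ^+ 2)
  (`|l| ^+ 2) (`|lam - lams| ^+ 2) '[w, q] '[w, v'] '[l, r'] '[lams, r'] '[l, s]
  '[lams, s] '[v', q] '[x', q] '[x', v'] => nv nq nx nu nu' nl' nl wq wv lr lsr ls lss
  vq xq xv.
move=> lam_le nx0 nq0 nv0 u_le SC1 SC2.
have da0 : 0 < delta * alpha * beta by rewrite !mulr_gt0.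
have d2b0 : 0 < delta ^+ 2 * beta by rewrite !mulr_gt0.
(* The strong convexity weights cancel the [w] terms of [u_le], and the multiplier weight cancels
   its [l] terms. *)
have {}SC1 := ler_wpM2l (ltW da0) SC1.
have {}SC2 := ler_wpM2l (ltW d2b0) SC2.
have {}lam_le := ler_wpM2l (ltW d0) lam_le.
(* The leftovers are nonnegative: [T1] to [T3] use the slack in the growth of [beta], [T4] the
   decrease of [eps], and the others are weighted squares. *)
have g0 : 0 <= delta * (delta * beta + alpha * beta - delta * beta').
  by rewrite mulr_ge0 ?subr_ge0// ltW.
have T1 := mulr_ge0 g0 D'0.
have T2 := mulr_ge0 (mulr_ge0 g0 mu0) nq0.
have T3 := mulr_ge0 (mulr_ge0 g0 e0) nx0.
have T4 : 0 <= delta ^+ 2 * beta' * (eps - eps') * nx.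
  by rewrite !mulr_ge0 ?subr_ge0 ?(ltW d0).
have T5 : 0 <= (delta * gamma - 1) * alpha * (alpha + delta) * nv.
  by rewrite !mulr_ge0 ?(addr_ge0 (ltW a0) (ltW d0)) ?(ltW a0).
have T6 : 0 <= (delta * gamma - 1) * alpha * delta * nv.
  by rewrite !mulr_ge0 ?(ltW a0) ?(ltW d0).
have T7 : 0 <= mu * (delta * (delta * alpha * beta)) * nv.
  by rewrite !mulr_ge0 ?(ltW a0) ?(ltW b0) ?(ltW d0).
have T71 : 0 <= mu * (delta * delta * (delta * alpha * beta)) * nv.
  by rewrite !mulr_ge0 ?(ltW a0) ?(ltW b0) ?(ltW d0).
have T8 : 0 <= mu * (delta ^+ 2 * beta) * alpha ^+ 2 * nv.
  by rewrite !mulr_ge0 ?(ltW a0) ?(ltW b0) ?(ltW d0).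
have T9 : 0 <= eps * (delta ^+ 2 * beta) * alpha ^+ 2 * nv.
  by rewrite !mulr_ge0 ?(ltW a0) ?(ltW b0) ?(ltW d0).
have T10 : 0 <= eps * (delta * alpha * beta) * nq.
  by rewrite !mulr_ge0 ?(ltW a0) ?(ltW b0) ?(ltW d0).
clear -u_le SC1 SC2 lam_le T1 T2 T3 T4 T5 T6 T7 T71 T8 T9 T10.
lra.
Qed.
End Descent.

(** * From the algorithm to the implicit Euler step *)

(** Turns vector equations into scalar ones that [ring] and [field] can decide. *)
Lemma inner_ext {R : realType} {X : hilbertType R} (u v : X) :
  (forall d, '[u, d] = '[v, d]) -> u = v.
Proof.
move=> uv; apply/eqP; rewrite -subr_eq0 -normr_eq0 -sqrf_eq0 -inner_norm.
by rewrite innerDl innerNl uv subrr.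
Qed.

(** The smooth part of the subproblem is quadratic, so Fermat's rule gives its optimality condition,
    rewritten here in terms of the velocities [v] and [v']. *)
Lemma primal_dual_step {R : realType} {X Z : hilbertType R} (f : X -> \bar R)
    (A : {linear X -> Z}) (b : Z) (mu delta gamma alpha beta eps : R)
    (x x' zeta zeta' : X) (lam lam' : Z) :
  continuous A -> S0 mu f -> 0 <= mu -> 0 < delta -> 0 < gamma ->
  0 < alpha -> 0 < beta ->
  let theta := (alpha + delta) * beta in
  let eta := gamma + alpha^-1 + mu * delta * beta in
  let lamt := lam - (delta * beta) *: (A x - b) in
  let xt := x + eta^-1 *: (zeta - gamma *: x) in
  let zetad := delta *: zeta' + (1 - delta * gamma) *: x' in
  argmin (fun y => aug_lagrangian f A b theta y lamt
                   + (eta / (2 * alpha * beta) * `|y - xt| ^+ 2)%:E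
                   + (eps / 2 * `|y| ^+ 2)%:E)%E x' ->
  zeta' = (gamma + alpha^-1) *: x' - alpha^-1 *: x ->
  lam' = lam + (alpha * beta) *: (A zetad - b) ->
  let v := zeta - gamma *: x in
  let v' := zeta' - gamma *: x' in
  [/\ f x' \is a fin_num, x' = x + alpha *: v',
      lam' = lam + (alpha * beta) *: (A x' - b + delta *: A v') &
      exists w y : X, [/\ subdifferential f x' w,
        forall d, '[y, d] = '[lam', A d] &
        v = v' + (alpha * gamma) *: v' +
          (alpha * beta) *: (w + y + (mu * delta) *: v' + eps *: x')]].
Proof.
move=> contA f_S0 mu0 d0 g0 a0 b0 theta eta lamt xt zetad x'_min zeta'E lam'E v v'.
have eta_gt0 : 0 < eta.
  by rewrite ltr_wpDr ?addr_gt0 ?invr_gt0// !mulr_ge0// ltW.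
have [a_neq0 b_neq0 eta_neq0] : [/\ alpha != 0, beta != 0 & eta != 0].
  by rewrite !gt_eqF.
have x'E : x' = x + alpha *: v'.
  by apply: inner_ext => d; rewrite /v' zeta'E !innerE; field.
have zetadE : zetad = x' + delta *: v'.
  by apply: inner_ext => d; rewrite /zetad /v' !innerE; ring.
have {}lam'E : lam' = lam + (alpha * beta) *: (A x' - b + delta *: A v').
  by rewrite lam'E zetadE (linearD A) linearZ_LR addrAC.
(* The choice of [theta] makes the gradient of the multiplier and penalty terms at [x'] equal to
   [A^* lam'], with the updated multiplier. *)
have lamtE : lamt + theta *: (A x' - b) = lam'.
  have Ax : A x = A x' - alpha *: A v'.
    by rewrite -linearZ_LR -(linearB A) x'E addrK.
  by apply: inner_ext => d; rewrite lam'E /lamt Ax /theta !innerE; ring.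
have [y yE] := adjoint_vector lam' contA.
case: (f_S0) => f_proper f_cvx _ _.
(* [q] is the smooth part of the subproblem, [g] its gradient at [x'], and [h] its pure quadratic
   part. *)
pose c := eta / (2 * alpha * beta).
pose q z := '[lamt, A z - b] + theta / 2 * `|A z - b| ^+ 2
  + c * `|z - xt| ^+ 2 + eps / 2 * `|z| ^+ 2.
pose h d := theta / 2 * `|A d| ^+ 2 + c * `|d| ^+ 2 + eps / 2 * `|d| ^+ 2.
pose g := y + (2 * c) *: (x' - xt) + eps *: x'.
have q_quad d t : q (x' + t *: d) = q x' + t * '[g, d] + t ^+ 2 * h d.
  rewrite /q /h /g.
  have -> : A (x' + t *: d) - b = A x' - b + t *: A d.
    by rewrite (linearD A) linearZ_LR addrAC.
  have -> : x' + t *: d - xt = x' - xt + t *: d by rewrite addrAC.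
  rewrite !sqr_normD !normrZ !exprMn !real_normK ?num_real//.
  rewrite [in RHS]innerDl [in RHS]innerDl yE -lamtE.
  move: (A x' - b) (x' - xt) => r p.
  rewrite !innerE; field.
  exact: eta_neq0.
have q_min : argmin (fun z => f z + (q z)%:E)%E x'.
  move=> z; have := x'_min z.
  by rewrite /aug_lagrangian /lagrangian -!addeA -!EFinD /q /c !addrA.
have [fx' w_sub] := argmin_subgradient f_proper f_cvx q_min q_quad.
split=> //; exists (- g), y; split=> //.
have xtE : x' - xt = alpha *: v' - eta^-1 *: v.
  by rewrite x'E /xt opprD addrACA subrr add0r.
apply: inner_ext => d; rewrite /g xtE.
(* With this value of [eta] the proximal gradient absorbs exactly the inertial, friction and [mu]
   multiples of [v'], leaving [v]. *)
have etaE : alpha * eta = alpha * gamma + 1 + alpha * (mu * delta * beta).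
  by rewrite /eta; field.
move: eta_neq0; rewrite /c; clearbody v v' eta; move=> eta_neq0.
rewrite !innerE.
transitivity ('[v', d] * (1 + alpha * gamma + alpha * beta * (mu * delta)
  - alpha * eta) + '[v, d]).
  by rewrite etaE; ring.
by field; rewrite a_neq0 b_neq0 eta_neq0.
Qed.

(** * Bounds for recursions and series; feasibility of saddle points *)

(** Each [s n.+1] is the convex combination of [s n] and [c n] with weights 1 / (1 + t) and t / (1 +
    t). *)
Lemma weighted_mean_bounded {R : realType} {V : normedModType R}
    (s c : nat -> V) (t : nat -> R) (M : R) :
  (forall n, 0 <= t n) -> (forall n, `|c n| <= M) ->
  (forall n, (1 + t n) *: s n.+1 = s n + t n *: c n) ->
  forall n, `|s n| <= Num.max `|s 0| M.
Proof.
move=> t0 cM sE; elim=> [|n IH]; first by rewrite le_max lexx.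
have t1 : 0 < 1 + t n by rewrite ltr_wpDr.
rewrite -(ler_pM2l t1) -{1}(gtr0_norm t1) -normrZ sE.
rewrite (le_trans (ler_normD _ _))// normrZ (ger0_norm (t0 n)) mulrDl mul1r.
by rewrite lerD// ler_wpM2l// le_max cM orbT.
Qed.

(** A crude bound replacing a square root, enough for boundedness. *)
Lemma le_of_sqr_le {R : realType} (a C : R) : a ^+ 2 <= C -> a <= C + 1.
Proof. by have := sqr_ge0 (a - 1); nra. Qed.

Lemma partial_sums_bounded {R : realType} (u : nat -> R) :
  (forall k, (1 <= k)%N -> 0 <= u k) -> (\sum_(1 <= k <oo) (u k)%:E < +oo)%E ->
  exists S, forall n, \sum_(1 <= k < n) u k <= S.
Proof.
move=> u0 uoo; exists (fine (\sum_(1 <= k <oo) (u k)%:E)%E) => n.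
have u0' k : (1 <= k)%N -> (0 <= (u k)%:E)%E by rewrite lee_fin => /u0.
rewrite -lee_fin fineK; last first.
  by rewrite ge0_fin_numE//; apply: nneseries_ge0 => k k1 _; exact: u0'.
rewrite -sumEFin; apply: nneseries_lim_ge => k k1 _; exact: u0'.
Qed.

(** Comparison with a point where [f] is finite gives finiteness; testing the multiplier
    [lams + (A xs - b)] forces the squared residual to be at most 0. *)
Lemma saddle_point_feasible {R : realType} {X Z : hilbertType R}
    (f : X -> \bar R) (A : {linear X -> Z}) (b : Z) (xs : X) (lams : Z) :
  Defs.proper f -> saddle_points f A b (xs, lams) ->
  f xs \is a fin_num /\ A xs = b.
Proof.
move=> [f_noo [y0 fy0]] saddle.
have fxs : f xs \is a fin_num.
  rewrite fin_numE f_noo/=; apply/eqP => fxs.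
  have [_] := saddle y0 lams; rewrite /lagrangian/= fxs addye// => H.
  have fy0_fin : f y0 \is a fin_num by rewrite fin_numE f_noo lt_eqF.
  by move: H; rewrite -(fineK fy0_fin) -EFinD.
split=> //; apply/eqP; rewrite -subr_eq0 -normr_eq0 -sqrf_eq0 -inner_norm.
have [+ _] := saddle xs (lams + (A xs - b)).
rewrite /lagrangian/= -(fineK fxs) -!EFinD lee_fin lerD2l innerDl gerDl => H.
by rewrite eq_le H inner_ge0.
Qed.

(** * Boundedness of the iterates and the convergence rates *)

Theorem corollary3 (R : realType) (X Z : hilbertType R)
    (f : X -> \bar R) (A : {linear X -> Z}) (b : Z)
    (mu delta gamma : R) (alpha beta epsilon : nat -> R)
    (x zeta : nat -> X) (lam : nat -> Z) (xs : X) (lams : Z)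
    (contA : continuous A)
    (mu_ge0 : 0 <= mu) (f_S0 : S0 mu f)
    (sol_neq0 : solutions f A b !=set0)
    (beta_gt0 : forall k, (1 <= k)%N -> 0 < beta k)
    (beta_nd : forall k, (1 <= k)%N -> beta k <= beta k.+1)
    (beta_oo : beta k @[k --> \oo] --> +oo)
    (alpha_gt0 : forall k, (1 <= k)%N -> 0 < alpha k)
    (delta_gt0 : 0 < delta) (gamma_gt0 : 0 < gamma)
    (dg_ge0 : 0 <= delta * gamma - 1)
    (beta_growth : forall k, (1 <= k)%N ->
       delta * beta k.+1 <= delta * beta k + alpha k * beta k)
    (algo : primal_dual_algorithm f A b mu delta gamma alpha beta epsilon
              x zeta lam)
    (saddle : saddle_points f A b (xs, lams))
    (eps_ge0 : forall k, (1 <= k)%N -> 0 <= epsilon k)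
    (eps_ni : forall k, (1 <= k)%N -> epsilon k.+1 <= epsilon k)
    (eps_sum : (\sum_(1 <= k <oo) (alpha k * beta k * epsilon k)%:E < +oo)%E) :
  [/\ [bounded (x k, lam k) | k in [set k | (1 <= k)%N]],
      ebigO (fun k => lagrangian f A b (x k) lams - lagrangian f A b xs lams)%E
            (fun k => (beta k)^-1),
      ebigO (fun k => `|f (x k) - f xs|)%E (fun k => (beta k)^-1) &
      (fun k => `|A (x k) - b| : R^o) =O_\oo (fun k => (beta k)^-1 : R^o)].
Proof.
have [f_proper _ _ _] := f_S0.
have [fxs Axs] := saddle_point_feasible f_proper saddle.
have [_ _ _ step] := algo.
pose v k := zeta k - gamma *: x k.
pose r k := A (x k) - b.
pose D k := fine (f (x k)) - fine (f xs) + '[lams, r k].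
have {}step k (k1 : (1 <= k)%N) : [/\ f (x k.+1) \is a fin_num,
    x k.+1 = x k + alpha k *: v k.+1,
    lam k.+1 = lam k + (alpha k * beta k) *: (r k.+1 + delta *: A (v k.+1)) &
    exists w y : X, [/\ subdifferential f (x k.+1) w,
      forall d, '[y, d] = '[lam k.+1, A d] &
      v k = v k.+1 + (alpha k * gamma) *: v k.+1 + (alpha k * beta k) *:
        (w + y + (mu * delta) *: v k.+1 + epsilon k *: x k.+1)]].
  have [x_min zetaE lamE] := step k k1.
  have := primal_dual_step contA f_S0 mu_ge0 delta_gt0 gamma_gt0
    (alpha_gt0 _ k1) (beta_gt0 _ k1) x_min zetaE lamE.
  by [].
have f_fin k : (2 <= k)%N -> f (x k) \is a fin_num.
  by case: k => // k k1; case: (step k k1).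
have lagrE k : (2 <= k)%N ->
    (lagrangian f A b (x k) lams - lagrangian f A b xs lams = (D k)%:E)%E.
  move=> /f_fin fxk; rewrite /lagrangian Axs subrr (linear0r inner) adde0.
  rewrite -(fineK fxk) -(fineK fxs) -EFinD /D /r.
  by congr (_%:E); ring.
have D_ge0 k : (2 <= k)%N -> 0 <= D k.
  move=> k2; rewrite -lee_fin -lagrE// sube_ge0; last first.
    by rewrite /lagrangian Axs subrr (linear0r inner) adde0 fxs.
  by have [_] := saddle (x k) lams.
pose E k := energy mu delta gamma xs lams (beta k) (epsilon k) (D k) (x k) (v k) (lam k).
pose K := delta / 2 * `|xs| ^+ 2.
have E_step k : (2 <= k)%N ->
    E k.+1 <= E k + K * (alpha k * beta k * epsilon k).
  move=> k2; have k1 := ltnW k2.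
  have [fx' x'E lam'E [w [y [w_sub yE vE]]]] := step k k1.
  have SC1 := S0_strong_convexity f_S0 w_sub fx' fxs.
  have SC2 := S0_strong_convexity f_S0 w_sub fx' (f_fin _ k2).
  have a0 := alpha_gt0 k k1; have b0 := beta_gt0 k k1.
  have b'0 := ltW (beta_gt0 k.+1 isT).
  apply: (@energy_step _ _ _ mu delta gamma xs lams (alpha k) (beta k) (beta k.+1)
    (epsilon k) (epsilon k.+1) (D k) (D k.+1) (x k) (x k.+1) (v k) (v k.+1) w y
    (lam k) (lam k.+1) (r k) (r k.+1) (A (v k.+1))) => //.
  - by rewrite eps_ge0 ?eps_ni.
  - exact: beta_growth.
  - exact: D_ge0.
  - by rewrite /r {1}x'E (linearD A) linearZ_LR addrAC.
  - by rewrite yE (linearB A) Axs.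
  - by apply: le_trans SC1 _; rewrite /D; lra.
  - by apply: le_trans SC2 _; rewrite /D; lra.
pose a k := alpha k * beta k * epsilon k.
have a_ge0 k : (1 <= k)%N -> 0 <= a k.
  by move=> k1; rewrite !mulr_ge0 ?eps_ge0 ?ltW ?alpha_gt0 ?beta_gt0.
have [S S_ub] := partial_sums_bounded a_ge0 eps_sum.
have K_ge0 : 0 <= K by rewrite mulr_ge0 ?sqr_ge0// divr_ge0 ?ltW.
have [C E_ub] : exists C, forall k, (2 <= k)%N -> E k <= C.
  (* The energy inequality is summed from index 2; the extra term [a 1] in the sum is nonnegative
     and only enlarges the bound. *)
  exists (E 2%N + K * S) => -[|[|n]]// _.
  apply: (@le_trans _ _ (E 2%N + K * \sum_(1 <= k < n.+2) a k)); last first.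
    by rewrite lerD2l ler_wpM2l.
  elim: n => [|n IH]; first by rewrite big_nat1 lerDl mulr_ge0 ?a_ge0.
  rewrite (le_trans (E_step n.+2 isT))// big_nat_recr//= mulrDr addrA.
  by rewrite lerD2r.
have bounds k : (2 <= k)%N -> [/\ delta ^+ 2 * beta k * D k <= C,
    `|x k - xs + delta *: v k| ^+ 2 <= 2 * C &
    `|lam k - lams| ^+ 2 <= 2 / delta * C].
  move=> k2; have k1 := ltnW k2.
  have [D_le u_le lam_le] := energy_bounds xs lams (x k) (v k) (lam k) mu_ge0
    delta_gt0 dg_ge0 (ltW (beta_gt0 k k1)) (eps_ge0 k k1) (D_ge0 k k2).
  have Ek := E_ub k k2; split.
  - exact: le_trans D_le Ek.
  - by have := le_trans u_le Ek; lra.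
  - rewrite mulrAC ler_pdivlMr//; have := le_trans lam_le Ek; lra.
pose ML := 2 / delta * C + 1 + `|lams|.
have lam_ub k : (2 <= k)%N -> `|lam k| <= ML.
  move=> /bounds[_ _ /le_of_sqr_le lam_le].
  by rewrite -(subrK lams (lam k)) (le_trans (ler_normD _ _))// lerD2r.
pose MX := Num.max `|x 2%N - xs| (2 * C + 1) + `|xs|.
have x_ub k : (2 <= k)%N -> `|x k| <= MX.
  case: k => [|[|n]]// _.
  rewrite -(subrK xs (x n.+2)) (le_trans (ler_normD _ _))// lerD2r.
  (* The weight [alpha / delta] comes from eliminating the old iterate through
     [x' = x + alpha *: v']. *)
  apply: (@weighted_mean_bounded _ _ (fun n => x n.+2 - xs)
    (fun n => x n.+3 - xs + delta *: v n.+3) (fun n => alpha n.+2 / delta)) => m.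
  - by rewrite divr_ge0 ?ltW ?alpha_gt0.
  - by have [_ /le_of_sqr_le] := bounds m.+3 isT.
  - have [_ xE _ _] := step m.+2 isT.
    have -> : x m.+2 = x m.+3 - alpha m.+2 *: v m.+3 by rewrite xE addrK.
    move: (x m.+3) (v m.+3) => x' v'.
    by apply: inner_ext => d; rewrite !innerE; field; rewrite gt_eqF.
pose MH := Num.max `|(delta * beta 2%N) *: r 2%N - lam 2%N| ML + ML.
have h_ub k : (2 <= k)%N -> `|(delta * beta k) *: r k| <= MH.
  case: k => [|[|n]]// _.
  rewrite -(subrK (lam n.+2) (_ *: _)) (le_trans (ler_normD _ _))// lerD ?lam_ub//.
  (* The slack of the growth condition relative to [delta * beta n.+3]: it is nonnegative, and 1 + t
     is (delta + alpha) beta at [n.+2] divided by that quantity. *)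
  pose t n := (delta * beta n.+2 + alpha n.+2 * beta n.+2 - delta * beta n.+3)
    / (delta * beta n.+3).
  apply: (@weighted_mean_bounded _ _
    (fun n => (delta * beta n.+2) *: r n.+2 - lam n.+2)
    (fun n => - lam n.+3) t) => m.
  - by rewrite divr_ge0 ?subr_ge0 ?beta_growth// mulr_ge0 ?ltW ?beta_gt0.
  - by rewrite normrN lam_ub.
  - have [_ xE lamE _] := step m.+2 isT.
    have rE : r m.+2 = r m.+3 - alpha m.+2 *: A (v m.+3).
      by rewrite /r xE (linearD A) linearZ_LR addrAC addrK.
    have b0 := beta_gt0 m.+3 isT.
    rewrite lamE rE /t; move: (r m.+3) (A (v m.+3)) => r' s'.
    apply: inner_ext => d; rewrite !innerE; field.
    by rewrite !gt_eqF.
pose CR := MH / delta.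
have r_ub k : (2 <= k)%N -> `|r k| <= CR * (beta k)^-1.
  move=> k2; have b0 := beta_gt0 k (ltnW k2).
  have := h_ub k k2; rewrite normrZ gtr0_norm ?mulr_gt0// => H.
  by rewrite /CR -mulrA -invfM ler_pdivlMr ?mulr_gt0// mulrC.
pose CD := C / delta ^+ 2.
have D_ub k : (2 <= k)%N -> D k <= CD * (beta k)^-1.
  move=> k2; have b0 := beta_gt0 k (ltnW k2).
  have [H _ _] := bounds k k2.
  by rewrite /CD -mulrA -invfM ler_pdivlMr ?mulr_gt0 ?exprn_gt0// mulrC.
have norm_Vb k : (2 <= k)%N -> `|(beta k)^-1| = (beta k)^-1.
  by move=> k2; rewrite gtr0_norm// invr_gt0 beta_gt0// ltnW.
split.
(* The estimates start at index 2, so the norms of the first iterates are added. *)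
- exists (MX + ML + `|x 1%N| + `|lam 1%N|); split => [|N /ltW N_ge k /= k1].
    exact: num_real.
  apply: le_trans N_ge.
  have MX0 := le_trans (normr_ge0 _) (x_ub 2%N isT).
  have ML0 := le_trans (normr_ge0 _) (lam_ub 2%N isT).
  rewrite prod_normE/= ge_max.
  have x0 := normr_ge0 (x 1%N); have l0 := normr_ge0 (lam 1%N).
  have [->|k2] : k = 1%N \/ (2 <= k)%N by case: k k1 => [|[|k]]; auto.
    by apply/andP; split; lra.
  by have := x_ub k k2; have := lam_ub k k2 => ? ?; apply/andP; split; lra.
- exists CD; exists 2%N => // k /= k2.
  by rewrite lagrE// norm_Vb//= lee_fin ger0_norm ?D_ge0// D_ub.
- exists (CD + `|lams| * CR); exists 2%N => // k /= k2.
  rewrite norm_Vb// -(fineK (f_fin k k2)) -(fineK fxs) -EFinB/= lee_fin normr_id.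
  (* The objective gap differs from the Lagrangian gap by a term linear in the residual, so both
     earlier rates combine. *)
  have -> : fine (f (x k)) - fine (f xs) = D k - '[lams, r k] by rewrite /D addrK.
  rewrite (le_trans (ler_normB _ _))// mulrDl lerD//.
    by rewrite ger0_norm ?D_ge0// D_ub.
  rewrite (le_trans (normr_inner_le _ _))// -mulrA ler_wpM2l//.
  exact: r_ub.
(* The constant has to be positive, whereas [CR] may vanish. *)
- apply/eqO_exP; exists (`|CR| + 1); first by rewrite ltr_wpDl.
  exists 2%N => // k /= k2; rewrite normr_id norm_Vb//.
  have b0 : 0 <= (beta k)^-1 by rewrite invr_ge0 (ltW (beta_gt0 k (ltnW k2))).
  rewrite (le_trans (r_ub k k2))// ler_wpM2r//.
  by rewrite (le_trans (ler_norm _))// lerDl.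
Qed.
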